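(* Let $S$ be an inverse semigroup. The equivalence, given by $\Phi$ and $\Psi$, between the category of $S$-sets and the category of pullback preserving functors $L(S)\to\mathsf{Sets}$ restricts to an equivalence between the category of transitive $S$-sets and the category of directed pullback preserving functors $L(S)\to\mathsf{Sets}$.
   Context: $S$ is an inverse semigroup, $E(S)$ its semilattice of idempotents, $\mathbf{d}(s)=s^{-1}s$, $\mathbf{r}(s)=ss^{-1}$, and $s\le t$ means $s=te$ for some $e\in E(S)$. Loganathan's category $L(S)$: objects are the elements of $E(S)$; arrows are pairs $(f,s)$ with $f\in E(S)$, $s\in S$, $\mathbf{r}(s)\le f$, regarded as an arrow from $\mathbf{d}(s)$ to $f$; composition is $(f,s)(\mathbf{d}(s),t)=(f,st)$. $S$-sets: an $S$-set $(X,\mu)$ is a set $X$ with a semigroup homomorphism $\mu\colon S\to\mathcal{I}(X)$ into the symmetric inverse semigroup of partial bijections of $X$; write $s\cdot x=\mu(s)(x)$ where defined. $S$-sets are assumed effective: for every $x\in X$ there is $s\in S$ with $s\cdot x$ defined. A morphism $(X,\mu)\to(Y,\nu)$ is a map $f\colon X\to Y$ such that whenever $s\cdot x$ is defined, the action of $s$ on $f(x)$ is defined and equals $f(s\cdot x)$. An $S$-set is transitive if it is nonempty and for any $x,y\in X$ there is $s\in S$ with $s\cdot x=y$. Transitive $S$-sets form a full subcategory of the category of $S$-sets; categories of functors have natural transformations as morphisms. Directed functors: the category of elements $\int_{\mathcal{C}}A$ of a functor $A\colon\mathcal{C}\to\mathsf{Sets}$ has objects the pairs $(C,p)$ with $p\in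 A(C)$ and arrows $(C,p)\to(C',p')$ the arrows $u\colon C\to C'$ with $A(u)(p)=p'$. A small category $I$ is directed if it has at least one object and for any objects $i,j$ there is a diagram $i\leftarrow k\to j$ in $I$. $A$ is directed if $\int_{\mathcal{C}}A$ is directed. The functors $\Phi,\Psi$: $\Phi(X,\mu)(e)=\{x\in X: e\cdot x\text{ is defined}\}$; $\Phi(X,\mu)(f,s)$ is the map $x\mapsto s\cdot x$ from $\Phi(X,\mu)(\mathbf{d}(s))$ to $\Phi(X,\mu)(f)$; on a morphism $g$, $\Phi(g)$ has components the restrictions of $g$. For a pullback preserving functor $F\colon L(S)\to\mathsf{Sets}$, $\Psi(F)=\left(\bigcup_{e\in E(S)}\{e\}\times F(e)\right)/\sim$, where $\sim$ is the equivalence relation generated by $(e,x)\sim(e',F(e',e)(x))$ for $e\le e'$, $x\in F(e)$; with $[e,x]$ the class of $(e,x)$, $s\circ\alpha$ is defined iff $\alpha=[\mathbf{d}(s),x]$ for some $x$, and then $s\circ\alpha=[\mathbf{r}(s),F(\mathbf{r}(s),s)(x)]$. For a natural transformation $\alpha\colon F\to F'$, $\Psi(\alpha)$ is $[e,x]\mapsto[e,\alpha(e)(x)]$. It is known that $\Phi$ and $\Psi$ give an equivalence between the category of $S$-sets and the category of pullback preserving functors $L(S)\to\mathsf{Sets}$. *)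

(* Defs.v *)
From HB Require Import structures.
From mathcomp Require Import all_boot.
From mathcomp Require Import boolp.
From mathcomp Require Import monoid.
From Stdlib Require Import Relation_Operators.

Set Implicit Arguments.
Unset Strict Implicit.
Unset Printing Implicit Defensive.

Declare Scope cat_scope.
Delimit Scope cat_scope with cat.
Local Open Scope cat_scope.

Record category := Category {
  obj :> Type;
  hom : obj -> obj -> Type;
  idc : forall a, hom a a;
  comp : forall a b c, hom b c -> hom a b -> hom a c;
  comp1c : forall a b (u : hom a b), comp (idc b) u = u;
  compc1 : forall a b (u : hom a b), comp u (idc a) = u;
  compA : forall a b c d (u : hom c d) (v : hom b c) (w : hom a b),
    comp u (comp v w) = comp (comp u v) w
}.

Arguments hom {_} a b.
Arguments idc {_} a.
Arguments comp {_ a b c} u v.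

Notation "u \oc v" := (comp u v) (at level 50, left associativity) : cat_scope.

Record functor (C D : category) := Functor {
  fobj :> C -> D;
  fmap : forall a b, hom a b -> hom (fobj a) (fobj b);
  fmap1 : forall a, fmap (idc a) = idc (fobj a);
  fmapM : forall a b c (u : hom b c) (v : hom a b),
    fmap (u \oc v) = fmap u \oc fmap v
}.

Arguments fmap {C D} F {a b} u : rename.

Record nattrans (C D : category) (F G : functor C D) := NatTrans {
  ncomp :> forall a, hom (F a) (G a);
  natural : forall a b (u : hom a b),
    ncomp b \oc fmap F u = fmap G u \oc ncomp a
}.

Lemma nattrans_eq C D (F G : functor C D) (s t : nattrans F G) :
  (forall a, s a = t a) -> s = t.
Proof.
case: s t => [s sn] [t tn] /= st.
have E : s = t by apply: functional_extensionality_dep.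
by case: _ / E in tn *; congr NatTrans; exact: Prop_irrelevance.
Qed.

Definition functor_id (C : category) : functor C C :=
  @Functor C C id (fun _ _ u => u) (fun _ => erefl) (fun _ _ _ _ _ => erefl).

Section FunctorComp.
Variables (C D E : category) (G : functor D E) (F : functor C D).

Lemma functor_comp1 a :
  fmap G (fmap F (idc a)) = idc (G (F a)).
Proof. by rewrite !fmap1. Qed.

Lemma functor_compM a b c (u : hom b c) (v : hom a b) :
  fmap G (fmap F (u \oc v)) = fmap G (fmap F u) \oc fmap G (fmap F v).
Proof. by rewrite !fmapM. Qed.

Definition functor_comp : functor C E :=
  @Functor C E (fun a => G (F a)) (fun _ _ u => fmap G (fmap F u))
    functor_comp1 functor_compM.
End FunctorComp.

Definition is_iso (C : category) (a b : C) (u : hom a b) :=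
  exists v : hom b a, v \oc u = idc a /\ u \oc v = idc b.

Definition nat_isomorphic (C D : category) (F G : functor C D) :=
  exists t : nattrans F G, forall a, is_iso (t a).

Definition is_equivalence (C D : category) (F : functor C D)
    (G : functor D C) :=
  nat_isomorphic (functor_comp G F) (functor_id C) /\
  nat_isomorphic (functor_comp F G) (functor_id D).

Section FullSubcategory.
Variables (C : category) (P : C -> Prop).

Let sobj := {a : C | P a}.
Let shom (a b : sobj) := hom (sval a) (sval b).

Definition full_subcategory : category :=
  @Category sobj shom (fun a => idc (sval a))
    (fun a b c (u : shom b c) (v : shom a b) => u \oc v)
    (fun a b u => comp1c u) (fun a b u => compc1 u)
    (fun a b c d u v w => compA u v w).
End FullSubcategory.

Section Restriction.
Variables (C D : category) (P : C -> Prop) (Q : D -> Prop) (F : functor C D).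
Hypothesis PQ : forall a, P a -> Q (F a).

Definition functor_restr :
    functor (full_subcategory P) (full_subcategory Q) :=
  @Functor (full_subcategory P) (full_subcategory Q)
    (fun a => exist Q (F (sval a)) (PQ (svalP a)))
    (fun _ _ u => fmap F u)
    (fun a => fmap1 F (sval a)) (fun _ _ _ u v => fmapM F u v).
End Restriction.

Section FunctorCategory.
Variables C D : category.

Definition nattrans_id (F : functor C D) : nattrans F F.
Proof.
exists (fun a => idc (F a)) => a b u.
by rewrite comp1c compc1.
Defined.

Definition nattrans_comp (F G H : functor C D)
  (t : nattrans G H) (s : nattrans F G) : nattrans F H.
Proof.
exists (fun a => t a \oc s a) => a b u.
by rewrite -compA natural compA natural compA.
Defined.

Lemma nattrans_comp1c F G (s : nattrans F G) :
  nattrans_comp (nattrans_id G) s = s.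
Proof. by apply: nattrans_eq => a /=; rewrite comp1c. Qed.

Lemma nattrans_compc1 F G (s : nattrans F G) :
  nattrans_comp s (nattrans_id F) = s.
Proof. by apply: nattrans_eq => a /=; rewrite compc1. Qed.

Lemma nattrans_compA F G H K (t : nattrans H K) (s : nattrans G H)
    (r : nattrans F G) :
  nattrans_comp t (nattrans_comp s r) = nattrans_comp (nattrans_comp t s) r.
Proof. by apply: nattrans_eq => a /=; rewrite compA. Qed.

Definition functor_category : category :=
  @Category (functor C D) (@nattrans C D) nattrans_id nattrans_comp
    nattrans_comp1c nattrans_compc1 nattrans_compA.
End FunctorCategory.

Definition Sets : category :=
  @Category Type (fun A B => A -> B) (fun A => id)
    (fun _ _ _ u v x => u (v x))
    (fun _ _ _ => erefl) (fun _ _ _ => erefl) (fun _ _ _ _ _ _ _ => erefl).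

Definition is_pullback (C : category) (p a b c : C)
    (pa : hom p a) (pb : hom p b) (u : hom a c) (v : hom b c) :=
  u \oc pa = v \oc pb /\
  forall (q : C) (qa : hom q a) (qb : hom q b), u \oc qa = v \oc qb ->
    exists! w : hom q p, pa \oc w = qa /\ pb \oc w = qb.

Definition pullback_preserving (C D : category) (F : functor C D) :=
  forall (p a b c : C) (pa : hom p a) (pb : hom p b) (u : hom a c)
    (v : hom b c),
  is_pullback pa pb u v ->
  is_pullback (fmap F pa) (fmap F pb) (fmap F u) (fmap F v).

Section Elements.
Variables (C : category) (A : functor C Sets).

Let eobj := {a : C & A a}.
Let ehom (x y : eobj) :=
  {u : hom (tag x) (tag y) | fmap A u (tagged x) = tagged y}.

Lemma elements_eq x y (u v : ehom x y) : sval u = sval v -> u = v.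
Proof.
case: u v => [u p] [v q] /= uv; case: _ / uv in q *.
by congr exist; exact: Prop_irrelevance.
Qed.

Definition elements_id (x : eobj) : ehom x x.
Proof. by exists (idc (tag x)); rewrite fmap1. Defined.

Definition elements_comp (x y z : eobj) (u : ehom y z) (v : ehom x y) :
  ehom x z.
Proof.
by exists (sval u \oc sval v); rewrite fmapM /= (svalP v) (svalP u).
Defined.

Lemma elements_comp1c x y (u : ehom x y) : elements_comp (elements_id y) u = u.
Proof. by apply: elements_eq; rewrite /= comp1c. Qed.

Lemma elements_compc1 x y (u : ehom x y) : elements_comp u (elements_id x) = u.
Proof. by apply: elements_eq; rewrite /= compc1. Qed.

Lemma elements_compA x y z t (u : ehom z t) (v : ehom y z) (w : ehom x y) :
  elements_comp u (elements_comp v w) = elements_comp (elements_comp u v) w.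
Proof. by apply: elements_eq; rewrite /= compA. Qed.

Definition elements : category :=
  @Category eobj ehom elements_id elements_comp
    elements_comp1c elements_compc1 elements_compA.
End Elements.

Definition directed_category (I : category) :=
  inhabited I /\
  forall i j : I, exists k : I, inhabited (hom k i) /\ inhabited (hom k j).

Definition directed_functor (C : category) (A : functor C Sets) :=
  directed_category (elements A).

(* [sinv s] is the unique inverse of s. As semigroupType extends choiceType,
   the carrier has a choice operator; boolp provides one for any type. *)
HB.mixin Record Semigroup_isInverse S of Semigroup S := {
  sinv : S -> S;
  mulsVs : forall s : S, (s * sinv s * s = s)%g;
  mulVsV : forall s : S, (sinv s * s * sinv s = sinv s)%g;
  sinv_uniq : forall s t : S, (s * t * s = s)%g -> (t * s * t = t)%g ->
    t = sinv s
}.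

#[short(type="inverseSemigroupType")]
HB.structure Definition InverseSemigroup :=
  {S of Semigroup_isInverse S & Semigroup S}.

Local Open Scope group_scope.
Notation "s ^*" := (sinv s) : group_scope.

Definition idempotent_of (S : inverseSemigroupType) : Type :=
  {e : S | e * e == e}.
Notation "''E' ( S )" := (idempotent_of S) (format "''E' ( S )") : type_scope.

Section InverseSemigroupTheory.
Variable S : inverseSemigroupType.
Implicit Types (s t : S) (e f g : 'E(S)).

Lemma idemE e : sval e * sval e = sval e. Proof. exact: eqP (svalP e). Qed.

Lemma idem_inj e f : sval e = sval f -> e = f.
Proof. exact: val_inj. Qed.

Definition Idem s (h : s * s = s) : 'E(S) := exist _ s (introT eqP h).

Lemma sdom_proof s : (s^* * s) * (s^* * s) = s^* * s.
Proof. by rewrite !mulgA mulVsV. Qed.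

Lemma sran_proof s : (s * s^* ) * (s * s^* ) = s * s^*.
Proof. by rewrite !mulgA mulsVs. Qed.

Definition sdom s : 'E(S) := Idem (sdom_proof s).
Definition sran s : 'E(S) := Idem (sran_proof s).

Definition sle s t := exists e : 'E(S), s = t * sval e.

Lemma sinvK s : s^*^* = s.
Proof. by symmetry; apply: sinv_uniq; rewrite ?mulsVs ?mulVsV. Qed.

Lemma idemV e : (sval e)^* = sval e.
Proof. by symmetry; apply: sinv_uniq; rewrite !idemE. Qed.

Let idem_mul_proof e f :
  (sval e * sval f) * (sval e * sval f) = sval e * sval f.
Proof.
have := mulsVs (sval e * sval f); have := mulVsV (sval e * sval f).
set x := (sval e * sval f)^* => h1 h2.
have xE : sval f * x * sval e = x.
  apply: sinv_uniq.
    by rewrite -[RHS]h2 !mulgA -(mulgA (sval e) (sval f) (sval f)) idemE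
      -(mulgA _ (sval e) (sval e)) idemE.
  rewrite -[in RHS]h1 !mulgA -(mulgA _ (sval e) (sval e)) idemE
    -(mulgA _ (sval f) (sval f)) idemE.
  by rewrite -!mulgA.
have xx : x * x = x.
  by rewrite -{1 2}xE -[in RHS]xE -[in RHS]h1 -!mulgA.
have xV : x^* = x by symmetry; apply: sinv_uniq; rewrite !xx.
by rewrite -(sinvK (sval e * sval f)) -/x xV.
Qed.

Lemma idemC e f : sval e * sval f = sval f * sval e.
Proof.
have E (a b : 'E(S)) :
    (sval a * sval b) * (sval b * sval a) * (sval a * sval b)
    = sval a * sval b.
  rewrite -!mulgA (mulgA (sval a) (sval a)) idemE.
  rewrite (mulgA (sval b) (sval b)) idemE.
  by rewrite !mulgA -(mulgA (sval a * sval b)) idem_mul_proof.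
have h : sval f * sval e = (sval e * sval f)^*.
  by apply: sinv_uniq; rewrite E.
have := @sinv_uniq _ (sval e * sval f) (sval e * sval f).
by rewrite !idem_mul_proof h; apply.
Qed.

Definition idem_mul e f : 'E(S) := Idem (idem_mul_proof e f).

Lemma sinvM s t : (s * t)^* = t^* * s^*.
Proof.
have c := idemC (sran t) (sdom s); rewrite /= in c.
symmetry; apply: sinv_uniq.
  rewrite -!mulgA (mulgA t) (mulgA s^* ) (mulgA (t * _)) c.
  by rewrite !mulgA mulsVs -!mulgA (mulgA t) mulsVs.
rewrite -!mulgA (mulgA s^* s) (mulgA t t^* ) (mulgA (s^* * s)) -c.
by rewrite !mulgA mulVsV -!mulgA (mulgA s^* ) mulVsV.
Qed.

Lemma sle_idem s f : sle s (sval f) -> sval f * s = s.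
Proof. by case=> e ->; rewrite mulgA idemE. Qed.

Lemma sle_idemP e f : sle (sval e) (sval f) <-> sval f * sval e = sval e.
Proof. by split=> [/sle_idem|h]; last by exists e. Qed.

Lemma ran_sleP s f : sle (sval (sran s)) (sval f) <-> sval f * s = s.
Proof.
rewrite sle_idemP /=; split=> [h|fs]; last by rewrite mulgA fs.
by rewrite -{1}(mulsVs s) mulgA h mulsVs.
Qed.

Lemma mulsd s : s * sval (sdom s) = s. Proof. by rewrite /= mulgA mulsVs. Qed.
Lemma mulrs s : sval (sran s) * s = s. Proof. by rewrite /= mulsVs. Qed.

Lemma sdom_idem e : sdom (sval e) = e.
Proof. by apply: idem_inj; rewrite /= idemV idemE. Qed.

Lemma sran_idem e : sran (sval e) = e.
Proof. by apply: idem_inj; rewrite /= idemV idemE. Qed.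

End InverseSemigroupTheory.

Section Loganathan.
Variable S : inverseSemigroupType.

(* The arrows (f, s) with sdom s = e; the component f is the codomain. *)
Record loganathan_hom (e f : 'E(S)) := LHom {
  lelt : S;
  ldom : sdom lelt = e;
  lran : sle (sval (sran lelt)) (sval f)
}.

Lemma lhom_eq e f (u v : loganathan_hom e f) : lelt u = lelt v -> u = v.
Proof.
case: u v => [s sd sr] [t td tr] /= st; case: _ / st in td tr *.
by congr LHom; exact: Prop_irrelevance.
Qed.

Lemma lelt_dom e f (u : loganathan_hom e f) : lelt u * sval e = lelt u.
Proof. by rewrite -(congr1 sval (ldom u)) mulsd. Qed.

Lemma lelt_ran e f (u : loganathan_hom e f) : sval f * lelt u = lelt u.
Proof. by apply/ran_sleP; exact: lran. Qed.

Lemma lelt_domE e f (u : loganathan_hom e f) :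
  (lelt u)^* * lelt u = sval e.
Proof. by rewrite -(congr1 sval (ldom u)). Qed.

Lemma lhom_id_ran (e : 'E(S)) : sle (sval (sran (sval e))) (sval e).
Proof. by apply/ran_sleP; rewrite idemE. Qed.

Definition lhom_id (e : 'E(S)) : loganathan_hom e e :=
  LHom (sdom_idem e) (lhom_id_ran e).

Section Comp.
Variables (e f g : 'E(S)) (u : loganathan_hom f g) (v : loganathan_hom e f).

Lemma lhom_comp_dom : sdom (lelt u * lelt v) = e.
Proof.
apply: idem_inj; rewrite /= sinvM -mulgA (mulgA (lelt u)^* ) lelt_domE.
by rewrite lelt_ran lelt_domE.
Qed.

Lemma lhom_comp_ran : sle (sval (sran (lelt u * lelt v))) (sval g).
Proof. by apply/ran_sleP; rewrite mulgA lelt_ran. Qed.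

Definition lhom_comp : loganathan_hom e g := LHom lhom_comp_dom lhom_comp_ran.
End Comp.

Lemma lhom_comp1c e f (u : loganathan_hom e f) : lhom_comp (lhom_id f) u = u.
Proof. by apply: lhom_eq; exact: lelt_ran. Qed.

Lemma lhom_compc1 e f (u : loganathan_hom e f) : lhom_comp u (lhom_id e) = u.
Proof. by apply: lhom_eq; exact: lelt_dom. Qed.

Lemma lhom_compA e f g h (u : loganathan_hom g h) (v : loganathan_hom f g)
    (w : loganathan_hom e f) :
  lhom_comp u (lhom_comp v w) = lhom_comp (lhom_comp u v) w.
Proof. by apply: lhom_eq; exact: mulgA. Qed.

Definition loganathan : category :=
  @Category 'E(S) loganathan_hom lhom_id lhom_comp
    lhom_comp1c lhom_compc1 lhom_compA.

(* The arrow (sran s, s) : sdom s -> sran s. *)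
Lemma arr_ran (s : S) : sle (sval (sran s)) (sval (sran s)).
Proof. by apply/ran_sleP; exact: mulrs. Qed.

Definition arr (s : S) : hom (sdom s : loganathan) (sran s) :=
  LHom erefl (arr_ran s).

(* The arrow (f, e) : e -> f, for e <= f. *)
Lemma incl_ran (e f : 'E(S)) (h : sle (sval e) (sval f)) :
  sle (sval (sran (sval e))) (sval f).
Proof. by rewrite sran_idem. Qed.

Definition incl (e f : 'E(S)) (h : sle (sval e) (sval f)) :
    hom (e : loganathan) f :=
  LHom (sdom_idem e) (incl_ran h).
End Loganathan.

Arguments incl {S e f} h.

(* A partial bijection of X is given by its graph: [pb f x y] means that
   f x is defined and equal to y. *)
Record pbij (X : Type) := PBij {
  pb :> X -> X -> Prop;
  pb_fun : forall x y y', pb x y -> pb x y' -> y = y';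
  pb_inj : forall x x' y, pb x y -> pb x' y -> x = x'
}.

Section SymmetricInverseSemigroup.
Variable X : Type.
Implicit Types f g h : pbij X.

Lemma pbij_eq f g : (forall x y, f x y <-> g x y) -> f = g.
Proof.
case: f g => [f ff fi] [g gf gi] /= fg.
have E : f = g by do 2![apply: funext => ?]; exact/propext.
by case: _ / E in gf gi *; congr PBij; exact: Prop_irrelevance.
Qed.

Definition pbij_comp f g : pbij X.
Proof.
exists (fun x z => exists2 y, g x y & f y z).
- move=> x z z' [y xy yz] [y' xy' yz'].
  by case: _ / (pb_fun xy xy') in yz'; exact: pb_fun yz yz'.
- move=> x x' z [y xy yz] [y' xy' yz'].
  by case: _ / (pb_inj yz yz') in xy'; exact: pb_inj xy xy'.
Defined.

Definition pbij_inv f : pbij X :=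
  @PBij X (fun x y => f y x) (fun _ _ _ => @pb_inj _ f _ _ _)
    (fun _ _ _ => @pb_fun _ f _ _ _).

Lemma pbij_compA f g h :
  pbij_comp f (pbij_comp g h) = pbij_comp (pbij_comp f g) h.
Proof.
apply: pbij_eq => x y; split=> /=.
- by case=> z [w xw wz] zy; exists w => //; exists z.
- by case=> w xw [z wz zy]; exists z => //; exists w.
Qed.

HB.instance Definition _ := gen_eqMixin (pbij X).
HB.instance Definition _ := gen_choiceMixin (pbij X).
HB.instance Definition _ := isSemigroup.Build (pbij X) pbij_compA.

Lemma pbij_mulfVf f : f * pbij_inv f * f = f.
Proof.
apply: pbij_eq => x y; split=> /= [|xy].
- case=> z xz [w wz wy]; by case: _ / (pb_inj xz wz) in wy.
- by exists y => //; exists x.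
Qed.

Lemma pbij_mulVfV f : pbij_inv f * f * pbij_inv f = pbij_inv f.
Proof. exact: (pbij_mulfVf (pbij_inv f)). Qed.

Lemma pbij_inv_uniq f g : f * g * f = f -> g * f * g = g -> g = pbij_inv f.
Proof.
move=> fgf gfg; apply: pbij_eq => x y /=; split.
- move=> xy; have : (g * f * g)%g x y by rewrite gfg.
  case=> y' xy' [b fb by_].
  have E := pb_fun xy' xy; subst y'; have E := pb_inj xy by_.
  by subst b.
- move=> yx; have : (f * g * f)%g y x by rewrite fgf.
  case=> x' yx' [b gb fbx].
  have E := pb_fun yx' yx; subst x'; have E := pb_inj fbx yx.
  by subst b.
Qed.

HB.instance Definition _ := Semigroup_isInverse.Build (pbij X)
  pbij_mulfVf pbij_mulVfV pbij_inv_uniq.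
End SymmetricInverseSemigroup.

Section Sset.
Variable S : inverseSemigroupType.

(* Effective S-sets; [act X s x y] means that s . x is defined and equal
   to y. *)
Record sset := SSet {
  scar :> Type;
  act : {multiplicative S -> pbij scar};
  act_effective : forall x, exists s, exists y, act s x y
}.

Record smorphism (X Y : sset) := SMorphism {
  smap :> X -> Y;
  smapP : forall s (x y : X), act X s x y -> act Y s (smap x) (smap y)
}.

Lemma smorphism_eq (X Y : sset) (f g : smorphism X Y) :
  (forall x, f x = g x) -> f = g.
Proof.
case: f g => [f fP] [g gP] /= fg.
have E : f = g by exact: funext.
by case: _ / E in gP *; congr SMorphism; exact: Prop_irrelevance.
Qed.

Definition smorphism_id (X : sset) : smorphism X X :=
  @SMorphism X X id (fun _ _ _ => id).

Definition smorphism_comp (X Y Z : sset) (f : smorphism Y Z)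
    (g : smorphism X Y) : smorphism X Z :=
  @SMorphism X Z (fun x => f (g x)) (fun _ _ _ h => smapP f (smapP g h)).

Lemma smorphism_comp1c X Y (f : smorphism X Y) :
  smorphism_comp (smorphism_id Y) f = f.
Proof. exact: smorphism_eq. Qed.

Lemma smorphism_compc1 X Y (f : smorphism X Y) :
  smorphism_comp f (smorphism_id X) = f.
Proof. exact: smorphism_eq. Qed.

Lemma smorphism_compA X Y Z T (f : smorphism Z T) (g : smorphism Y Z)
    (h : smorphism X Y) :
  smorphism_comp f (smorphism_comp g h) = smorphism_comp (smorphism_comp f g) h.
Proof. exact: smorphism_eq. Qed.

Definition Ssets : category :=
  @Category sset smorphism smorphism_id smorphism_comp
    smorphism_comp1c smorphism_compc1 smorphism_compA.

Definition transitive_sset (X : sset) : Prop :=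
  inhabited X /\ forall x y : X, exists s, act X s x y.

Definition transitive_Ssets : category :=
  @full_subcategory Ssets transitive_sset.

Section Action.
Variable X : sset.
Implicit Types (s t : S) (e f : 'E(S)).

Lemma actM s t : act X (s * t) = act X s * act X t.
Proof. exact: gmulfM. Qed.

Lemma act_idem e x y : act X (sval e) x y -> x = y.
Proof.
move=> xy; have : act X (sval e * sval e) x y by rewrite idemE.
by rewrite actM => -[z xz zy]; rewrite (pb_inj zy xy) in xz; exact: pb_fun xz xy.
Qed.

Lemma actV s x y : act X s^* x y <-> act X s y x.
Proof.
suff -> : act X s^* = pbij_inv (act X s) by [].
by apply: pbij_inv_uniq; rewrite -!actM ?mulsVs ?mulVsV.
Qed.

Lemma act_dom s x y : act X s x y -> act X (sval (sdom s)) x x.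
Proof. by move=> xy; rewrite actM; exists y => //; exact/actV. Qed.

Lemma act_ran s x y : act X s x y -> act X (sval (sran s)) y y.
Proof. by move=> xy; rewrite actM; exists x => //; exact/actV. Qed.

Lemma act_defined s x y : act X (sval (sdom s)) x y -> exists z, act X s x z.
Proof. by rewrite actM => -[z xz _]; exists z. Qed.
End Action.
End Sset.

Arguments act {S} X : rename.

Section Phi.
Variable S : inverseSemigroupType.

Section Object.
Variable X : sset S.

Definition phi_obj (e : 'E(S)) : Type :=
  {x : X | exists y, act X (sval e) x y}.

Lemma phi_obj_eq e (x y : phi_obj e) : sval x = sval y -> x = y.
Proof.
case: x y => [x xP] [y yP] /= xy; case: _ / xy in yP *.
by congr exist; exact: Prop_irrelevance.
Qed.

Lemma phi_objP e (x : phi_obj e) : act X (sval e) (sval x) (sval x).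
Proof. by case: x => x [y xy] /=; rewrite {2}(act_idem xy). Qed.

Lemma phi_arr_defined e f (u : loganathan_hom e f) (x : phi_obj e) :
  exists y, act X (lelt u) (sval x) y.
Proof. by apply: (@act_defined _ X _ _ (sval x)); rewrite ldom; exact: phi_objP. Qed.

(* [phi_app u x] is s . x where u = (f, s). *)
Definition phi_app e f (u : loganathan_hom e f) (x : phi_obj e) : X :=
  sval (cid (phi_arr_defined u x)).

Lemma phi_appP e f (u : loganathan_hom e f) (x : phi_obj e) :
  act X (lelt u) (sval x) (phi_app u x).
Proof. exact: (svalP (cid (phi_arr_defined u x))). Qed.

Lemma phi_app_in e f (u : loganathan_hom e f) (x : phi_obj e) :
  exists y, act X (sval f) (phi_app u x) y.
Proof.
have := phi_appP u x; rewrite -{1}(lelt_ran u) actM => -[z xz zy].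
exists (phi_app u x); suff -> : phi_app u x = z by rewrite {2}(act_idem zy).
by rewrite (act_idem zy).
Qed.

Definition phi_arr e f (u : loganathan_hom e f) (x : phi_obj e) : phi_obj f :=
  exist _ (phi_app u x) (phi_app_in u x).

Lemma phi_arrP e f (u : loganathan_hom e f) (x : phi_obj e) (y : phi_obj f) :
  phi_arr u x = y <-> act X (lelt u) (sval x) (sval y).
Proof.
split=> [<-|xy]; first exact: phi_appP.
by apply: phi_obj_eq; exact: pb_fun (phi_appP u x) xy.
Qed.

Lemma phi_arr1 e : phi_arr (lhom_id e) = id.
Proof. by apply: funext => x; apply/phi_arrP; exact: phi_objP. Qed.

Lemma phi_arrM e f g (u : loganathan_hom f g) (v : loganathan_hom e f) :
  phi_arr (lhom_comp u v) = (fun x => phi_arr u (phi_arr v x)).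
Proof.
apply: funext => x; apply/phi_arrP; rewrite /= actM.
by exists (phi_app v x); [exact: phi_appP | exact: (phi_appP u (phi_arr v x))].
Qed.

Definition phi_functor : functor (loganathan S) Sets :=
  @Functor (loganathan S) Sets phi_obj phi_arr phi_arr1 phi_arrM.

Lemma phi_arr_inj e f (u : loganathan_hom e f) : injective (phi_arr u).
Proof.
move=> x x' /phi_arrP h; apply: phi_obj_eq.
exact: pb_inj h (phi_appP u x').
Qed.

Lemma phi_pullback : pullback_preserving phi_functor.
Proof.
move=> p a b c pa pb u v [comm univ]; split.
  by rewrite -!fmapM comm.
move=> T qa qb qab.
have ex t : exists w, phi_arr pa w = qa t /\ phi_arr pb w = qb t.
  have E : phi_arr u (qa t) = phi_arr v (qb t) by exact: (congr1 (@^~ t) qab).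
  set z := phi_app u (qa t).
  have uz : act X (lelt u) (sval (qa t)) z by exact: phi_appP.
  have vz : act X (lelt v) (sval (qb t)) z.
    by rewrite /z [phi_app u _](congr1 sval E); exact: phi_appP.
  pose k := idem_mul (sran (lelt u)) (sran (lelt v)).
  have kE : sval k = sval (sran (lelt u)) * sval (sran (lelt v)) by [].
  have ku : sval (sran (lelt u)) * sval k = sval k by rewrite kE mulgA idemE.
  have kv : sval (sran (lelt v)) * sval k = sval k.
    by rewrite kE idemC mulgA idemE.
  move: (k) (kE) ku kv => {kE}k kE ku kv.
  have kd e (w : loganathan_hom e c) : sval (sran (lelt w)) * sval k = sval k ->
      sdom ((lelt w)^* * sval k) = k.
    move=> kw; apply: idem_inj; rewrite /= sinvM sinvK idemV -mulgA.
    by rewrite (mulgA (lelt w)) kw idemE.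
  have kr e (w : loganathan_hom e c) :
      sle (sval (sran ((lelt w)^* * sval k))) (sval e).
    by apply/ran_sleP; rewrite mulgA -(lelt_domE w) mulVsV.
  pose ka : hom (k : loganathan S) a := LHom (kd _ _ ku) (kr _ _).
  pose kb : hom (k : loganathan S) b := LHom (kd _ _ kv) (kr _ _).
  have [|w [[wa wb] _]] := univ k ka kb.
    by apply: lhom_eq; rewrite /= !(mulgA (lelt _)) ku kv.
  have zk : exists y, act X (sval k) z y.
    exists z; rewrite kE actM; exists z; [exact: act_ran vz|exact: act_ran uz].
  have aux e (y : loganathan_hom e c) (x : phi_obj e) (m : loganathan_hom k e) :
      lelt m = (lelt y)^* * sval k -> act X (lelt y) (sval x) z ->
      phi_arr m (exist _ z zk) = x.
    move=> mE xz; apply/phi_arrP; rewrite mE actM /=.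
    exists z; last exact/actV.
    by have := phi_objP (exist _ z zk).
  exists (phi_arr w (exist _ z zk)).
  have paw : phi_arr (lhom_comp pa w) = _ := phi_arrM pa w.
  have pbw : phi_arr (lhom_comp pb w) = _ := phi_arrM pb w.
  split.
    rewrite -[LHS](congr1 (@^~ _) paw); apply: (aux _ u) => //.
    by rewrite [lhom_comp _ _]wa.
  rewrite -[LHS](congr1 (@^~ _) pbw); apply: (aux _ v) => //.
  by rewrite [lhom_comp _ _]wb.
have [w wP] := choice ex.
exists w; split.
  by split; apply: funext => t; case: (wP t).
move=> w' [w'a _]; apply: funext => t; apply: (@phi_arr_inj _ _ pa).
by have [-> _] := wP t; rewrite -w'a.
Qed.
End Object.

Section Morphism.
Variables (X Y : sset S) (g : smorphism X Y).

Lemma phi_map_in e (x : phi_obj X e) :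
  exists y, act Y (sval e) (g (sval x)) y.
Proof. by exists (g (sval x)); apply: smapP; exact: phi_objP. Qed.

Definition phi_map (e : 'E(S)) (x : phi_obj X e) : phi_obj Y e :=
  exist _ (g (sval x)) (phi_map_in x).

Lemma phi_map_natural e f (u : loganathan_hom e f) :
  (fun x => phi_map (phi_arr u x)) = (fun x => phi_arr u (phi_map x)).
Proof.
apply: funext => x; symmetry; apply/phi_arrP.
by apply: smapP; exact: phi_appP.
Qed.

Definition phi_nattrans : nattrans (phi_functor X) (phi_functor Y) :=
  @NatTrans _ _ (phi_functor X) (phi_functor Y) phi_map phi_map_natural.
End Morphism.

Definition pp_functors : category :=
  @full_subcategory (functor_category (loganathan S) Sets)
    (@pullback_preserving (loganathan S) Sets).

Definition directed_pp (F : pp_functors) : Prop := directed_functor (sval F).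

Definition directed_pp_functors : category := full_subcategory directed_pp.

Lemma phi1 X : phi_nattrans (smorphism_id X) = nattrans_id (phi_functor X).
Proof. by apply: nattrans_eq => e; apply: funext => x; exact: phi_obj_eq. Qed.

Lemma phiM X Y Z (g : smorphism Y Z) (h : smorphism X Y) :
  phi_nattrans (smorphism_comp g h) =
  nattrans_comp (phi_nattrans g) (phi_nattrans h).
Proof. by apply: nattrans_eq => e; apply: funext => x; exact: phi_obj_eq. Qed.

Definition Phi : functor (Ssets S) pp_functors :=
  @Functor (Ssets S) pp_functors
    (fun X => exist _ (phi_functor X) (@phi_pullback X))
    phi_nattrans phi1 phiM.
End Phi.

Section Psi.
Variable S : inverseSemigroupType.

Section Carrier.
Variable F : functor (loganathan S) Sets.

Definition germ : Type := {e : 'E(S) & F e}.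

Inductive germ_step : germ -> germ -> Prop :=
  GermStep (e e' : 'E(S)) (h : sle (sval e) (sval e')) (x : F e) :
    germ_step (existT _ e x) (existT _ e' (fmap F (incl h) x)).

Definition germ_rel : rel {classic germ} :=
  fun a b => `[< clos_refl_sym_trans germ germ_step a b >].

Lemma germ_rel_refl : reflexive germ_rel.
Proof. by move=> a; apply/asboolP; exact: rst_refl. Qed.

Lemma germ_rel_sym : symmetric germ_rel.
Proof. by move=> a b; apply/asboolP/asboolP => h; exact: rst_sym. Qed.

Lemma germ_rel_trans : transitive germ_rel.
Proof.
by move=> b a c /asboolP h /asboolP k; apply/asboolP; exact: rst_trans h k.
Qed.

Canonical germ_equiv : equiv_rel {classic germ} :=
  EquivRel _ germ_rel_refl germ_rel_sym germ_rel_trans.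

Definition psi_obj : Type := {eq_quot germ_equiv}%qT.

Definition psi_cls (e : 'E(S)) (x : F e) : psi_obj :=
  (\pi_({eq_quot germ_equiv}) (existT _ e x : {classic germ}))%qT.
Arguments psi_cls : clear implicits.

Lemma psi_objP (P : psi_obj -> Prop) :
  (forall e x, P (psi_cls e x)) -> forall a, P a.
Proof. by move=> h; apply: quotW => -[e x]; exact: h. Qed.

Lemma psi_clsP e x e' x' :
  psi_cls e x = psi_cls e' x' <->
  clos_refl_sym_trans germ germ_step (existT _ e x) (existT _ e' x').
Proof.
split=> [/eqmodP/asboolP //|h].
by apply/eqmodP/asboolP.
Qed.

Lemma psi_cls_incl e e' (h : sle (sval e) (sval e')) x :
  psi_cls e x = psi_cls e' (fmap F (incl h) x).
Proof. by apply/psi_clsP; apply: rst_step; exact: GermStep. Qed.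

Lemma fmap_app e f g (u : hom (f : loganathan S) g)
    (v : hom (e : loganathan S) f) (x : F e) :
  fmap F u (fmap F v x) = fmap F (u \oc v) x.
Proof. by rewrite fmapM. Qed.

Lemma fmap_id e (u : hom (e : loganathan S) e) (x : F e) :
  lelt u = sval e -> fmap F u x = x.
Proof.
move=> ue; have -> : u = idc (e : loganathan S) by exact: lhom_eq.
by rewrite fmap1.
Qed.

Lemma fmap_lelt e f (u v : hom (e : loganathan S) f) (x : F e) :
  lelt u = lelt v -> fmap F u x = fmap F v x.
Proof. by move=> /lhom_eq ->. Qed.

Lemma psi_cls_lelt e f f' (u : hom (e : loganathan S) f)
    (v : hom (e : loganathan S) f') (x : F e) :
  lelt u = lelt v -> psi_cls f (fmap F u x) = psi_cls f' (fmap F v x).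
Proof.
move=> uv.
have aux g (w : hom (e : loganathan S) g) : exists w' : hom (e : loganathan S)
    (sran (lelt w)), lelt w' = lelt w /\
    psi_cls g (fmap F w x) = psi_cls (sran (lelt w)) (fmap F w' x).
  exists (LHom (ldom w) (arr_ran (lelt w))); split=> //.
  rewrite (psi_cls_incl (lran w)) fmap_app; congr psi_cls.
  by apply: fmap_lelt; rewrite /= mulsVs.
have [u' [u'E ->]] := aux _ u; have [v' [v'E ->]] := aux _ v.
move: u' v' u'E v'E; rewrite -uv => u' v' u'E v'E; congr psi_cls.
by apply: fmap_lelt; rewrite u'E v'E.
Qed.

Lemma psi_cls_eq e f (u : hom (e : loganathan S) f) (x : F e) :
  lelt u = sval e -> psi_cls e x = psi_cls f (fmap F u x).
Proof.
move=> ue; rewrite -(@psi_cls_lelt _ _ _ (idc (e : loganathan S)) u) //.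
by rewrite fmap1.
Qed.

Hypothesis pp : pullback_preserving F.

Lemma incl_pullback (a b c : 'E(S)) (u : hom (a : loganathan S) c)
    (v : hom (b : loganathan S) c) (ue : lelt u = sval a)
    (ve : lelt v = sval b) (x : F a) (y : F b) :
  fmap F u x = fmap F v y ->
  exists g, exists ha : sle (sval g) (sval a),
  exists hb : sle (sval g) (sval b), exists z : F g,
    fmap F (incl ha) z = x /\ fmap F (incl hb) z = y.
Proof.
pose g := idem_mul a b.
have ha : sle (sval g) (sval a).
  by apply/sle_idemP; rewrite /= mulgA idemE.
have hb : sle (sval g) (sval b).
  by apply/sle_idemP; rewrite /= idemC mulgA idemE.
have sq : is_pullback (C := loganathan S) (incl ha : hom (g : loganathan S) a)
    (incl hb) u v.
  split.
    apply: lhom_eq; rewrite /= ue ve -/(sval g).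
    by rewrite !mulgA idemE (idemC b a) -mulgA idemE.
  move=> q qa qb qE.
  have qab : lelt qa = lelt qb.
    have := congr1 (@lelt S q c) qE.
    by rewrite /= ue ve !lelt_ran.
  have qr : sle (sval (sran (lelt qa))) (sval g).
    apply/ran_sleP; rewrite /= -mulgA [in sval b * _]qab.
    by rewrite lelt_ran -qab lelt_ran.
  exists (LHom (ldom qa) qr : hom q (g : loganathan S)); split.
    by split; apply: lhom_eq; rewrite /= -?qab; exact: (proj1 (ran_sleP _ _) qr).
  move=> w [wa _]; apply: lhom_eq; rewrite /= -(congr1 (@lelt S q a) wa) /=.
  by rewrite -[sval a * sval b]/(sval g) lelt_ran.
move=> xy; exists g, ha, hb.
have [_ univ] := pp sq.
have [|w [[wx wy] _]] := univ unit (fun _ => x) (fun _ => y).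
  by apply: funext.
exists (w tt); split.
- exact: (congr1 (@^~ tt) wx).
- exact: (congr1 (@^~ tt) wy).
Qed.

(* Equality of classes: a common restriction exists. *)
Definition germ_eq (a b : germ) : Prop :=
  exists g, exists ha : sle (sval g) (sval (tag a)),
  exists hb : sle (sval g) (sval (tag b)), exists z : F g,
    fmap F (incl ha) z = tagged a /\ fmap F (incl hb) z = tagged b.

Lemma sle_refl (e : 'E(S)) : sle (sval e) (sval e).
Proof. by apply/sle_idemP; rewrite idemE. Qed.

Lemma sle_trans (e f g : 'E(S)) :
  sle (sval e) (sval f) -> sle (sval f) (sval g) -> sle (sval e) (sval g).
Proof.
by move=> /sle_idemP h /sle_idemP k; apply/sle_idemP; rewrite -h mulgA k.
Qed.

Lemma germ_eqP (a b : germ) :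
  clos_refl_sym_trans germ germ_step a b -> germ_eq a b.
Proof.
elim=> {a b} [a b [e e' h x]|[e x]|a b _ [g [ha [hb [z [za zb]]]]]|].
- exists e, (sle_refl e), h, x; split=> //=.
  exact: fmap_id.
- by exists e, (sle_refl e), (sle_refl e), x; split; exact: fmap_id.
- by exists g, hb, ha, z.
- move=> a b c _ [g [ga [gb [z [za zb]]]]] _ [h [hb [hc [w [wb wc]]]]].
  have [|k [kg [kh [t [tz tw]]]]] :=
    @incl_pullback _ _ _ (incl gb) (incl hb) erefl erefl z w.
    by rewrite zb wb.
  exists k, (sle_trans kg ga), (sle_trans kh hc), t.
  rewrite -za -wc -tz -tw !fmap_app.
  split; apply: fmap_lelt => /=; symmetry.
  + exact: (sle_idem (proj2 (sle_idemP _ _) (proj1 (sle_idemP _ _) kg))).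
  + exact: (sle_idem (proj2 (sle_idemP _ _) (proj1 (sle_idemP _ _) kh))).
Qed.

Lemma psi_cls_inj e : injective (psi_cls e).
Proof.
move=> x x' /psi_clsP/germ_eqP[g [/= h [h' [z [<- <-]]]]].
exact: fmap_lelt.
Qed.

Lemma fmap_inj e f (u : hom (e : loganathan S) f) : injective (fmap F u).
Proof.
have vd : sdom (lelt u)^* = sran (lelt u).
  by apply: idem_inj; rewrite /= sinvK.
have vr : sle (sval (sran (lelt u)^* )) (sval e).
  by apply/ran_sleP; rewrite -(lelt_domE u) mulVsV.
pose v : hom (sran (lelt u) : loganathan S) e := LHom vd vr.
pose u' : hom (e : loganathan S) (sran (lelt u)) :=
  LHom (ldom u) (arr_ran (lelt u)).
move=> x x' xx'.
have : psi_cls _ (fmap F u' x) = psi_cls _ (fmap F u' x').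
  by rewrite (@psi_cls_lelt _ _ _ u' u) // (@psi_cls_lelt _ _ _ u' u) // xx'.
move=> /psi_cls_inj /(congr1 (fmap F v)); rewrite !fmap_app.
by rewrite !fmap_id //= lelt_domE.
Qed.

(* Graph of s o [d(s), x] = [r(s), F(r(s), s)(x)]. *)
Definition psi_graph (s : S) (a b : psi_obj) : Prop :=
  exists x : F (sdom s),
    a = psi_cls (sdom s) x /\ b = psi_cls (sran s) (fmap F (arr s) x).

Lemma psi_graph_fun s a b b' : psi_graph s a b -> psi_graph s a b' -> b = b'.
Proof. by move=> [x [-> ->]] [x' [/psi_cls_inj <- ->]]. Qed.

Lemma psi_graph_inj s a a' b : psi_graph s a b -> psi_graph s a' b -> a = a'.
Proof. by move=> [x [-> ->]] [x' [-> /psi_cls_inj/fmap_inj ->]]. Qed.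

Definition psi_act (s : S) : pbij psi_obj :=
  PBij (@psi_graph_fun s) (@psi_graph_inj s).

Lemma psi_actM s t : psi_act (s * t) = psi_act s * psi_act t.
Proof.
apply: pbij_eq => a b; split=> [[x [-> ->]]|].
  have h1 : sle (sval (sdom (s * t))) (sval (sdom t)).
    apply/sle_idemP; rewrite /= sinvM.
    by rewrite !mulgA mulVsV.
  have d2 : sdom (t * sval (sdom (s * t))) = sdom (s * t).
    have td := sle_idem h1; rewrite [sval (sdom t)]/= in td.
    move: (sdom (s * t)) td => d td; apply: idem_inj.
    have -> : sval (sdom (t * sval d)) = (t * sval d)^* * (t * sval d) by [].
    by rewrite sinvM idemV -mulgA (mulgA t^* ) td idemE.
  have E2 : t * sval (sdom (s * t)) = sval (sdom s) * t.
    have c := idemC (sran t) (sdom s); rewrite /= in c; rewrite /= sinvM.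
    have -> : t * (t^* * s^* * (s * t)) = ((t * t^* ) * (s^* * s)) * t.
      by rewrite !mulgA.
    by rewrite c -mulgA mulsVs.
  have r2 : sle (sval (sran (t * sval (sdom (s * t))))) (sval (sdom s)).
    by apply/ran_sleP; rewrite E2 mulgA idemE.
  pose v : hom (sdom (s * t) : loganathan S) (sdom s) := LHom d2 r2.
  exists (psi_cls (sdom s) (fmap F v x)).
    exists (fmap F (incl h1) x); split; first exact: psi_cls_incl.
    by rewrite fmap_app; exact: psi_cls_lelt.
  exists (fmap F v x); split=> //.
  rewrite fmap_app; apply: psi_cls_lelt.
  have -> : lelt (arr s \oc v) = s * t * sval (sdom (s * t)).
    by rewrite -mulgA.
  by rewrite mulsd.
move=> [c [x [-> ->]] [y [xy ->]]].
have [g [gr [gd [z [zx zy]]]]] := germ_eqP (proj1 (psi_clsP _ _) xy).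
rewrite /= in zx zy.
have gt : t * t^* * sval g = sval g by exact: (sle_idem gr).
have gs : s^* * s * sval g = sval g by exact: (sle_idem gd).
have vd : sdom (t^* * sval g) = g.
  by apply: idem_inj; rewrite /= sinvM sinvK idemV -mulgA (mulgA t) gt idemE.
have vr : sle (sval (sran (t^* * sval g))) (sval (sdom t)).
  by apply/ran_sleP; rewrite /= mulgA mulVsV.
have vr' : sle (sval (sran (t^* * sval g))) (sval (sdom (s * t))).
  apply/ran_sleP; rewrite /= sinvM.
  by rewrite -!mulgA (mulgA t t^* ) gt (mulgA s^* s) gs.
pose v : hom (g : loganathan S) (sdom t) := LHom vd vr.
pose v' : hom (g : loganathan S) (sdom (s * t)) := LHom vd vr'.
have xE : fmap F v z = x.
  apply: (fmap_inj (u := arr t)); rewrite -zx fmap_app.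
  by apply: fmap_lelt; rewrite /= mulgA gt.
exists (fmap F v' z); split.
  by rewrite -xE; exact: psi_cls_lelt.
rewrite -zy !fmap_app; apply: psi_cls_lelt.
by rewrite /= -!mulgA (mulgA t) gt.
Qed.

HB.instance Definition _ := isMultiplicative.Build S (pbij psi_obj) psi_act psi_actM.

Lemma psi_effective (a : psi_obj) : exists s, exists b, psi_act s a b.
Proof.
elim/psi_objP: a => e x; exists (sval e).
have h : sle (sval e) (sval (sdom (sval e))).
  by rewrite sdom_idem; exact: sle_refl.
exists (psi_cls (sran (sval e)) (fmap F (arr (sval e)) (fmap F (incl h) x))).
by exists (fmap F (incl h) x); split=> //; exact: psi_cls_incl.
Qed.

Definition psi_sset : sset S :=
  @SSet S psi_obj (psi_act : {multiplicative S -> pbij psi_obj}) psi_effective.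
End Carrier.

Arguments psi_cls F e x : clear implicits.

Section Morphism.
Variables (F G : functor (loganathan S) Sets) (alpha : nattrans F G).
Hypotheses (ppF : pullback_preserving F) (ppG : pullback_preserving G).

(* [e, x] |-> [e, alpha(e)(x)]; see psi_mapE. *)
Definition psi_map (a : psi_obj F) : psi_obj G :=
  let: existT e x := (repr a : germ F) in psi_cls G e (alpha e x).

Lemma nattrans_app e f (u : hom (e : loganathan S) f) (x : F e) :
  alpha f (fmap F u x) = fmap G u (alpha e x).
Proof. exact: (congr1 (@^~ x) (natural alpha u)). Qed.

Lemma psi_mapE e (x : F e) : psi_map (psi_cls F e x) = psi_cls G e (alpha e x).
Proof.
have : clos_refl_sym_trans _ (@germ_step F) (repr (psi_cls F e x))
    (existT _ e x).
  by apply/asboolP; apply/(@eqmodP _ (germ_equiv F)); rewrite reprK.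
rewrite /psi_map; move: (repr _) => a /=.
pose h (b : germ F) := let: existT e x := b in psi_cls G e (alpha e x).
suff H b : clos_refl_sym_trans _ (@germ_step F) a b -> h a = h b by exact: H.
elim=> {a b} [a b [f f' le y]|//|//|a b c _ -> _ ->//].
by rewrite /h nattrans_app; exact: psi_cls_incl.
Qed.

Lemma psi_mapP s (a b : psi_sset ppF) :
  act (psi_sset ppF) s a b -> act (psi_sset ppG) s (psi_map a) (psi_map b).
Proof.
move=> [x [-> ->]]; exists (alpha (sdom s) x).
by rewrite !psi_mapE nattrans_app.
Qed.

Definition psi_smorphism : smorphism (psi_sset ppF) (psi_sset ppG) :=
  SMorphism psi_mapP.
End Morphism.

Lemma psi1 (F : pp_functors S) :
  psi_smorphism (idc F) (svalP F) (svalP F) = smorphism_id _.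
Proof. by apply: smorphism_eq; elim/psi_objP => e x; rewrite /= psi_mapE. Qed.

Lemma psiM (F G H : pp_functors S) (beta : hom G H) (alpha : hom F G) :
  psi_smorphism (beta \oc alpha) (svalP F) (svalP H) =
  smorphism_comp (psi_smorphism beta (svalP G) (svalP H))
    (psi_smorphism alpha (svalP F) (svalP G)).
Proof. by apply: smorphism_eq; elim/psi_objP => e x; rewrite /= !psi_mapE. Qed.

Definition Psi : functor (pp_functors S) (Ssets S) :=
  @Functor (pp_functors S) (Ssets S) (fun F => psi_sset (svalP F))
    (fun F G alpha => psi_smorphism alpha (svalP F) (svalP G)) psi1 psiM.
End Psi.

(* Main.v *)
From mathcomp Require Import all_boot.
From mathcomp Require Import boolp.
From mathcomp Require Import monoid.
Require Import Defs.

Set Implicit Arguments.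
Unset Strict Implicit.
Unset Printing Implicit Defensive.

Local Open Scope cat_scope.
Local Open Scope group_scope.

(** The counit Psi (Phi X) -> X sends [e, x] to x, which is well defined since
    the arrows (e', e) act on X as idempotents, that is by restrictions of the
    identity (phi_cls_inj). Its inverse sends x to [e, x], where e is any
    idempotent defined at x: one exists because X is effective, and the choice
    does not matter because [e, x] and [f, x] are both equal to [ef, x]
    (phi_cls_eq). The unit F -> Phi (Psi F) sends x in F(e) to [e, x]: it is
    injective because F preserves pullbacks (psi_cls_inj), and it is onto
    because e acts only on classes [e, x].

    Everything about Psi F is driven by one formula (psi_act_cls): an arrow
    (f, s) : e -> f of L(S) satisfies s o [e, x] = [f, F(f, s)(x)]. It makes
    the unit natural, and it shows that a span (e, x) <- (g, z) -> (f, y)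
    in the category of elements, with legs given by s and t, produces the
    element t s^-1 which carries [e, x] to [f, y]. Conversely, if s . x = y
    in X with x in Phi(X)(e) and y in Phi(X)(f), then t = f s e still sends x
    to y, and x, seen over d(t) <= e, is the apex of a span to (e, x) and
    (f, y). So transitive S-sets and directed functors correspond, and an
    equivalence restricts to full subcategories that it respects. *)

(** * Isomorphisms of functors *)

Lemma nattrans_inverse (C D : category) (F G : functor C D)
    (t : nattrans F G) :
  (forall a, is_iso (t a)) ->
  exists t' : nattrans G F,
    forall a, t' a \oc t a = idc (F a) /\ t a \oc t' a = idc (G a).
Proof.
move=> ti; pose t' a : hom (G a) (F a) := sval (cid (ti a)).
have t'P a : t' a \oc t a = idc (F a) /\ t a \oc t' a = idc (G a).
  exact: svalP (cid (ti a)).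
have t'n a b (u : hom a b) : t' b \oc fmap G u = fmap F u \oc t' a.
  rewrite -[LHS]compc1 -(proj2 (t'P a)) compA -(compA (t' b)) -natural.
  by rewrite compA (proj1 (t'P b)) comp1c.
by exists (NatTrans t'n).
Qed.

Lemma nat_isomorphic_sym (C D : category) (F G : functor C D) :
  nat_isomorphic F G -> nat_isomorphic G F.
Proof.
move=> [t /nattrans_inverse[t' t'P]]; exists t' => a; exists (t a).
by have [] := t'P a.
Qed.

Lemma functor_category_iso (C D : category) (F G : functor C D)
    (t : nattrans F G) :
  (forall a, is_iso (t a)) -> is_iso (C := functor_category C D) t.
Proof.
move=> /nattrans_inverse[t' t'P]; exists t'.
by split; apply: nattrans_eq => a; have [] := t'P a.
Qed.

Lemma Sets_iso (A B : Type) (f : A -> B) :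
  injective f -> (forall y, exists x, f x = y) -> is_iso (C := Sets) f.
Proof.
move=> fi /choice[g fg]; exists g; split; apply: funext => x //=.
by apply: fi; rewrite fg.
Qed.

(** Arrows and composition of a full subcategory are those of the ambient
    category, so the components of the unit and of the counit can be reused
    unchanged. *)
Lemma equivalence_restr (C D : category) (P : C -> Prop) (Q : D -> Prop)
    (F : functor C D) (G : functor D C)
    (PQ : forall a, P a -> Q (F a)) (QP : forall b, Q b -> P (G b)) :
  is_equivalence F G ->
  is_equivalence (functor_restr PQ) (functor_restr QP).
Proof.
move=> [[t ti] [s si]]; split.
- by exists (@NatTrans _ _ (functor_comp (functor_restr QP) (functor_restr PQ))
    (functor_id _) (fun a => t (sval a)) (fun _ _ u => natural t u)) => a;
    exact: ti.
- by exists (@NatTrans _ _ (functor_comp (functor_restr PQ) (functor_restr QP))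
    (functor_id _) (fun a => s (sval a)) (fun _ _ u => natural s u)) => a;
    exact: si.
Qed.

(** * Psi after Phi *)

Section Counit.
Variable S : inverseSemigroupType.
Variable X : sset S.

Let F : functor (loganathan S) Sets := phi_functor X.

Lemma phi_cls_eq e f (x : phi_obj X e) (y : phi_obj X f) :
  sval x = sval y -> @psi_cls S F e x = @psi_cls S F f y.
Proof.
move=> xy; pose g := idem_mul e f.
have ge : sle (sval g) (sval e) by apply/sle_idemP; rewrite /= mulgA idemE.
have gf : sle (sval g) (sval f).
  by apply/sle_idemP; rewrite /= idemC mulgA idemE.
have gx : exists z, act X (sval g) (sval x) z.
  exists (sval x); rewrite actM; exists (sval x); last exact: phi_objP.
  by rewrite xy; exact: phi_objP.
pose z : phi_obj X g := exist _ (sval x) gx.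
have -> : x = fmap F (incl ge) z.
  by symmetry; apply/phi_arrP; exact: phi_objP z.
have -> : y = fmap F (incl gf) z.
  by symmetry; apply/phi_arrP; rewrite -xy; exact: phi_objP z.
by rewrite -!psi_cls_incl.
Qed.

Lemma phi_cls_inj e f (x : phi_obj X e) (y : phi_obj X f) :
  @psi_cls S F e x = @psi_cls S F f y -> sval x = sval y.
Proof.
move=> /psi_clsP/(germ_eqP (@phi_pullback S X))[g [ge [gf [z [zx zy]]]]].
(* The arrows (e, g) and (f, g) both act as the idempotent g, fixing z. *)
move: zx zy => /phi_arrP/act_idem /= <- /phi_arrP/act_idem /= <-.
by [].
Qed.

Lemma phi_counit_ex (a : psi_obj F) :
  exists y : X, forall e (x : phi_obj X e), a = @psi_cls S F e x -> y = sval x.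
Proof.
by elim/psi_objP: a => e x; exists (sval (x : phi_obj X e)) => f y /phi_cls_inj.
Qed.

Definition phi_counit (a : psi_obj F) : X := sval (cid (phi_counit_ex a)).

Lemma phi_counitE e (x : phi_obj X e) :
  phi_counit (@psi_cls S F e x) = sval x.
Proof. exact: (svalP (cid (phi_counit_ex (@psi_cls S F e x)))). Qed.

(** The counit is built for an arbitrary proof of pullback preservation, since
    the one carried by the object Phi(X) is opaque. *)
Hypothesis pp : pullback_preserving F.

Let Y : sset S := psi_sset pp.

Lemma phi_counitP s (a b : Y) :
  act Y s a b -> act X s (phi_counit a) (phi_counit b).
Proof.
move=> [x [-> ->]]; rewrite !phi_counitE.
exact: (phi_appP (arr s) x).
Qed.

Definition counit : smorphism Y X := SMorphism phi_counitP.

Lemma effective_idem (x : X) :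
  exists e : 'E(S), exists y, act X (sval e) x y.
Proof.
by have [s [y xy]] := act_effective x; exists (sdom s), x; exact: act_dom xy.
Qed.

Definition phi_counit_inv (x : X) : Y :=
  @psi_cls S F (sval (cid (effective_idem x)))
    (exist _ x (svalP (cid (effective_idem x)))).

Lemma phi_counit_invE e (x : phi_obj X e) :
  phi_counit_inv (sval x) = @psi_cls S F e x.
Proof. exact: phi_cls_eq. Qed.

Lemma phi_counit_invP s (x y : X) :
  act X s x y -> act Y s (phi_counit_inv x) (phi_counit_inv y).
Proof.
move=> xy.
pose x' : phi_obj X (sdom s) :=
  exist _ x (ex_intro _ x (act_dom xy)).
exists x'; split; first exact: (phi_counit_invE x').
have yE : sval (phi_arr (arr s) x') = y.
  exact: pb_fun (phi_appP (arr s) x') xy.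
by rewrite -{1}yE; exact: phi_counit_invE.
Qed.

Lemma counit_iso : is_iso (C := Ssets S) counit.
Proof.
exists (SMorphism phi_counit_invP); split; apply: smorphism_eq => a /=.
  by elim/psi_objP: a => e x; rewrite phi_counitE; exact: phi_counit_invE.
by rewrite /phi_counit_inv phi_counitE.
Qed.
End Counit.

Lemma Psi_Phi (S : inverseSemigroupType) :
  nat_isomorphic (functor_comp (Psi S) (Phi S)) (functor_id (Ssets S)).
Proof.
pose eps (X : Ssets S) :
    hom (functor_comp (Psi S) (Phi S) X) (functor_id (Ssets S) X) :=
    counit (svalP (Phi S X)).
have eps_natural (X Y : Ssets S) (g : hom X Y) :
    eps Y \oc fmap (functor_comp (Psi S) (Phi S)) g = g \oc eps X.
  apply: smorphism_eq => a /=; elim/psi_objP: a => e x.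
  by rewrite psi_mapE !phi_counitE.
by exists (NatTrans eps_natural) => X; exact: counit_iso (svalP (Phi S X)).
Qed.

(** * Phi after Psi *)

Section Unit.
Variable S : inverseSemigroupType.
Variable F : functor (loganathan S) Sets.
Hypothesis pp : pullback_preserving F.

Let X : sset S := psi_sset pp.

(** The definition of the action only covers the arrow (r(s), s); the general
    codomain f >= r(s) follows since the class does not see it. *)
Lemma psi_act_cls e f (u : hom (e : loganathan S) f) (x : F e) :
  act X (lelt u) (@psi_cls S F e x) (@psi_cls S F f (fmap F u x)).
Proof.
have h : sle (sval e) (sval (sdom (lelt u))) by rewrite ldom; exact: sle_refl.
exists (fmap F (incl h) x); split; first exact: psi_cls_incl.
by rewrite fmap_app; apply: psi_cls_lelt; rewrite /= lelt_dom.
Qed.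

Lemma psi_unit_in e (x : F e) :
  exists b, act X (sval e) (@psi_cls S F e x) b.
Proof.
by exists (@psi_cls S F e (fmap F (idc (e : loganathan S)) x));
  exact: (psi_act_cls (idc (e : loganathan S)) x).
Qed.

Definition psi_unit (e : loganathan S) : hom (F e) (phi_functor X e) :=
  fun x => exist _ (@psi_cls S F e x) (psi_unit_in x).
Arguments psi_unit : clear implicits.

Lemma psi_unit_natural (e f : loganathan S) (u : hom e f) :
  psi_unit f \oc fmap F u = fmap (phi_functor X) u \oc psi_unit e.
Proof.
by apply: funext => x; symmetry; apply/phi_arrP; exact: psi_act_cls.
Qed.

Definition unit_nattrans : nattrans F (phi_functor X) :=
  NatTrans psi_unit_natural.

Lemma psi_unit_iso e : is_iso (psi_unit e).
Proof.
apply: Sets_iso => [x y /(congr1 sval)/(psi_cls_inj pp)//|[a [b ab]]].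
have [x [aE _]] := ab.
have h : sle (sval (sdom (sval e))) (sval e).
  by rewrite sdom_idem; exact: sle_refl.
exists (fmap F (incl h) x); apply: phi_obj_eq; rewrite /= aE.
by rewrite -psi_cls_incl.
Qed.
End Unit.

Lemma Phi_Psi (S : inverseSemigroupType) :
  nat_isomorphic (functor_comp (Phi S) (Psi S)) (functor_id (pp_functors S)).
Proof.
apply: nat_isomorphic_sym.
pose eta (F : pp_functors S) :
    hom (functor_id (pp_functors S) F) (functor_comp (Phi S) (Psi S) F) :=
  unit_nattrans (svalP F).
have eta_natural (F G : pp_functors S) (t : hom F G) :
    eta G \oc t = fmap (functor_comp (Phi S) (Psi S)) t \oc eta F.
  apply: nattrans_eq => e; apply: funext => x; apply: phi_obj_eq => /=.
  by rewrite psi_mapE.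
exists (@NatTrans _ _ (functor_id _) (functor_comp (Phi S) (Psi S)) eta
  eta_natural) => F.
apply: (functor_category_iso (t := unit_nattrans (svalP F))) => e.
exact: psi_unit_iso.
Qed.

(** * Transitivity and directedness *)

Lemma transitive_directed (S : inverseSemigroupType) (X : Ssets S) :
  transitive_sset X -> directed_pp (Phi S X).
Proof.
move=> [[x0] tr]; split.
  have [e ex] := effective_idem x0.
  by constructor; exists e; exact: (exist _ x0 ex).
move=> [e x] [f y]; have [s xy] := tr (sval x) (sval y).
(* Cutting s down by e and f makes d(t) <= e and r(t) <= f, as the legs of the
   span require, without changing its value at x. *)
pose t := sval f * s * sval e.
have txy : act X t (sval x) (sval y).
  rewrite !actM; exists (sval x); first exact: phi_objP.
  by exists (sval y) => //; exact: phi_objP.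
have de : sle (sval (sdom t)) (sval e).
  have te : t * sval e = t by rewrite -mulgA idemE.
  have et : sval e * t^* = t^* by rewrite -[in RHS]te sinvM idemV.
  by apply/sle_idemP; rewrite [sval (sdom t)]/= mulgA et.
have rf : sle (sval (sran t)) (sval f).
  by apply/ran_sleP; rewrite /t !mulgA idemE.
pose z : phi_obj X (sdom t) := exist _ (sval x) (ex_intro _ _ (act_dom txy)).
pose v : hom (sdom t : loganathan S) f := LHom erefl rf.
exists (existT _ (sdom t : loganathan S) z); split; constructor.
  exists (incl de : hom (sdom t : loganathan S) e).
  by apply/phi_arrP; exact: phi_objP z.
by exists v; apply/phi_arrP.
Qed.

Lemma directed_transitive (S : inverseSemigroupType) (F : pp_functors S) :
  directed_pp F -> transitive_sset (Psi S F).
Proof.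
move=> [[[e x]] dir]; split; first exact: (inhabits (psi_cls x)).
move=> a b; elim/psi_objP: a => {}e {}x; elim/psi_objP: b => f y.
have [[g z] [[[u ux]] [[v vy]]]] := dir (existT _ e x) (existT _ f y).
rewrite /= in u ux v vy; exists (lelt v * (lelt u)^*).
rewrite actM; exists (@psi_cls S (sval F) g z).
  by apply/actV; rewrite -ux; exact: psi_act_cls.
by rewrite -vy; exact: psi_act_cls.
Qed.

Theorem proposition13 (S : inverseSemigroupType) :
  is_equivalence (Phi S) (Psi S) /\
  exists (PhiR : forall X : Ssets S, transitive_sset X -> directed_pp (Phi S X))
         (PsiR : forall F : pp_functors S,
                   directed_pp F -> transitive_sset (Psi S F)),
    @is_equivalence (transitive_Ssets S) (directed_pp_functors S)
      (functor_restr PhiR) (functor_restr PsiR).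
Proof.
have eqv : is_equivalence (Phi S) (Psi S).
  by split; [exact: Psi_Phi | exact: Phi_Psi].
split=> //; exists (@transitive_directed S), (@directed_transitive S).
exact: equivalence_restr eqv.
Qed.
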